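(* Let $T$ independent snapshots of a zero-mean circularly symmetric complex Gaussian vector in $\mathbb{C}^M$ be observed, with covariance $$\mathbf{R}_y^{\mathrm{PI}}=\rho\,\bigl[\mathbf{S}(\theta)\odot\mathbf{R}_b(\theta,\kappa,a_3)\bigr]+\sigma_n^2\mathbf{I}_M,$$ which is assumed positive definite. The parameters of interest are $\boldsymbol{\psi}=[\theta,\kappa,a_3]^T$ and the nuisance parameters are $\boldsymbol{\nu}=[\rho,\sigma_n^2]^T$. Let $\mathbf{F}$ be the $5\times5$ Fisher information matrix of $\mathbf{g}=[\boldsymbol{\psi}^T,\boldsymbol{\nu}^T]^T$, with entries $$[\mathbf{F}]_{ij}=T\,\mathrm{Re}\Bigl\{\mathbf{s}_{g_i}^{H}\bigl((\mathbf{R}_y^{\mathrm{PI}})^{-T}\otimes(\mathbf{R}_y^{\mathrm{PI}})^{-1}\bigr)\mathbf{s}_{g_j}\Bigr\},\qquad \mathbf{s}_{g_i}=\mathrm{vec}\Bigl(\frac{\partial\mathbf{R}_y^{\mathrm{PI}}}{\partial g_i}\Bigr),$$ partitioned into blocks $\mathbf{F}_{\psi\psi}\in\mathbb{R}^{3\times3}$, $\mathbf{F}_{\psi\nu}\in\mathbb{R}^{3\times 2}$, $\mathbf{F}_{\nu\psi}=\mathbf{F}_{\psi\nu}^T$, $\mathbf{F}_{\nu\nu}\in\mathbb{R}^{2\times2}$. Assume that $\mathbf{F}_{\nu\nu}$ and $\mathbf{F}$ are nonsingular. Then the Cramér--Rao lower bound matrix for $[\theta,\kappa,a_3]^T$ (with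 $\rho,\sigma_n^2$ unknown) is $$\mathbf{C}_{\mathrm{PI}}=\bigl(\mathbf{F}_{\psi\psi}-\mathbf{F}_{\psi\nu}\mathbf{F}_{\nu\nu}^{-1}\mathbf{F}_{\nu\psi}\bigr)^{-1},$$ and the marginal bounds are $\mathrm{CRLB}_{\mathrm{PI}}(\theta)=[\mathbf{C}_{\mathrm{PI}}]_{1,1}$, $\mathrm{CRLB}_{\mathrm{PI}}(\kappa)=[\mathbf{C}_{\mathrm{PI}}]_{2,2}$, $\mathrm{CRLB}_{\mathrm{PI}}(a_3)=[\mathbf{C}_{\mathrm{PI}}]_{3,3}$.
   Context: A uniform linear array has $M$ elements with spacing $d_0>0$ in wavelengths, and the source direction is $\theta\in(-\pi/2,\pi/2)$. The steering vector is $\mathbf{a}(\theta)=[1,e^{j2\pi d_0\sin\theta},\dots,e^{j2\pi(M-1)d_0\sin\theta}]^T$, and $\mathbf{S}(\theta)=\mathbf{a}(\theta)\mathbf{a}(\theta)^H$. The physics-informed distortion covariance $\mathbf{R}_b(\theta,\kappa,a_3)\in\mathbb{R}^{M\times M}$ has entries $[\mathbf{R}_b]_{mm}=1+2\lambda_{11}$ and, for $m\ne\ell$, $[\mathbf{R}_b]_{m\ell}=1+2\lambda_{11}\alpha_{|m-\ell|}$, where $\lambda_{11}>0$ is a known constant and $$\alpha_k=\exp\Bigl(-\kappa\,\frac{d_k(\theta)}{a_3 d_k(\theta)+1}\Bigr),\qquad d_k(\theta)=k d_0\cos\theta .$$ Here $\kappa=a_1R/(a_2R+1)$ combines the empirical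 coefficients $a_1,a_2$ and the propagation range $R$, and $a_3$ is a further empirical coefficient. The scalar $\rho=|\beta|^2\sigma_s^2>0$ is the effective received source power and $\sigma_n^2>0$ the noise variance. The symbol $\odot$ is the entrywise product, $\otimes$ the Kronecker product, $\mathrm{vec}$ the column-stacking operator, and $\mathbf{X}^{-T}=(\mathbf{X}^{-1})^T$. The Cramér--Rao lower bound matrix for a subvector of the parameters is the corresponding diagonal block of the inverse of the full Fisher information matrix; it lower-bounds (in the Loewner order) the covariance of any unbiased estimator of that subvector when all parameters are unknown. The marginal bounds are its diagonal entries. *)

(* Defs.v *)
From HB Require Import structures.
From mathcomp Require Import all_boot all_order all_algebra.
From mathcomp Require Import all_classical all_reals all_analysis.
From mathcomp.real_closed Require Import complex mxtens.

Set Implicit Arguments.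
Unset Strict Implicit.
Unset Printing Implicit Defensive.

Import Order.TTheory GRing.Theory Num.Theory.
Import numFieldNormedType.Exports.

Local Open Scope classical_set_scope.
Local Open Scope complex_scope.
Local Open Scope sesquilinear_scope.
Local Open Scope ring_scope.

Section LinearAlgebra.
Variable R : realType.

(* In the order of R[i], 0 < z means that z is real and positive, so this
   condition forces K to be Hermitian. *)
Definition posdefmx (M : nat) (K : 'M[R[i]]_M) : Prop :=
  forall x : 'cV[R[i]]_M, x != 0 -> 0 < (x ^t* *m K *m x) 0 0.

Definition hadamard (M N : nat) (A B : 'M[R[i]]_(M, N)) : 'M[R[i]]_(M, N) :=
  map2_mx *%R A B.

(* Column stacking: mxtens_index (l, m), whose value is l * M + m, holds the
   entry in row m and column l.  This is the index convention of the Kronecker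
   product A *t B. *)
Definition vec (M N : nat) (X : 'M[R[i]]_(M, N)) : 'cV[R[i]]_(N * M) :=
  \col_p X (mxtens_unindex p).2 (mxtens_unindex p).1.

End LinearAlgebra.

Section ArrayModel.
Variable R : realType.

Definition cis (x : R) : R[i] := cos x +i* sin x.

Definition steering (M : nat) (d0 theta : R) : 'cV[R[i]]_M :=
  \col_(m < M) cis (2 * pi * m%:R * d0 * sin theta).

Definition steering_cov (M : nat) (d0 theta : R) : 'M[R[i]]_M :=
  steering M d0 theta *m (steering M d0 theta) ^t*.

Definition proj_spacing (d0 theta : R) (k : nat) : R := k%:R * d0 * cos theta.

Definition alpha (d0 theta kappa a3 : R) (k : nat) : R :=
  expR (- (kappa * (proj_spacing d0 theta k
                    / (a3 * proj_spacing d0 theta k + 1)))).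

(* |m - l| is the distance between the naturals m and l, not the truncated
   difference. *)
Definition distortion_cov (M : nat) (d0 lambda11 theta kappa a3 : R) :
    'M[R]_M :=
  \matrix_(m, l)
    if m == l then 1 + 2 * lambda11
    else 1 + 2 * lambda11 * alpha d0 theta kappa a3 `|m - l|%N.

Definition cov_PI (M : nat) (d0 lambda11 theta kappa a3 rho sigma2 : R) :
    'M[R[i]]_M :=
  rho%:C *: hadamard (steering_cov M d0 theta)
              (map_mx (real_complex R)
                 (distortion_cov M d0 lambda11 theta kappa a3))
  + (sigma2%:C)%:M.

Definition params (theta kappa a3 rho sigma2 : R) : 'rV[R]_(3 + 2) :=
  row_mx (\row_(i < 3) [:: theta; kappa; a3]`_i)
         (\row_(i < 2) [:: rho; sigma2]`_i).

Definition cov_PI_of (M : nat) (d0 lambda11 : R) (g : 'rV[R]_(3 + 2)) :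
    'M[R[i]]_M :=
  cov_PI M d0 lambda11
    (g 0 (lshift 2 0)) (g 0 (lshift 2 1)) (g 0 (lshift 2 2%:R))
    (g 0 (rshift 3 0)) (g 0 (rshift 3 1)).

End ArrayModel.

Section GaussianSnapshots.
Variables (R : realType) (d : measure_display) (Omega : measurableType d).
Variable P : probability Omega R.

(* The generators of the sigma-algebra of a random complex vector. *)
Definition coordinate_events (M : nat) (y : Omega -> 'cV[R[i]]_M) :
    set (set Omega) :=
  [set E | exists (m : 'I_M) (B : set R), measurable B /\
     (E = (fun w => complex.Re (y w m 0)) @^-1` B \/
      E = (fun w => complex.Im (y w m 0)) @^-1` B)].

(* For positive definite K: y is Gaussian because all its nonzero real-linear
   functionals Re (c^H y) are, and it is centered, circularly symmetric and of
   covariance E[y y^H] = K because Re (c^H y) has mean 0 and variance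
   c^H K c / 2 for every complex c. The second argument of normal_prob is the
   standard deviation. *)
Definition circular_gaussian (M : nat) (y : Omega -> 'cV[R[i]]_M)
    (K : 'M[R[i]]_M) : Prop :=
  coordinate_events y `<=` measurable /\
  forall c : 'cV[R[i]]_M, c != 0 ->
  forall B : set R, measurable B ->
    P ((fun w => complex.Re ((c ^t* *m y w) 0 0)) @^-1` B) =
    normal_prob 0 (Num.sqrt (complex.Re ((c ^t* *m K *m c) 0 0) / 2)) B.

(* Subfamilies are covered by taking E t = setT for the other indices. *)
Definition independent_vectors (T M : nat)
    (y : 'I_T -> Omega -> 'cV[R[i]]_M) : Prop :=
  forall E : 'I_T -> set Omega,
    (forall t, <<s coordinate_events (y t) >> (E t)) ->
    P (\bigcap_(t in [set: 'I_T]) E t) = (\prod_(t < T) P (E t))%E.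

Definition gaussian_snapshots (T M : nat)
    (y : 'I_T -> Omega -> 'cV[R[i]]_M) (K : 'M[R[i]]_M) : Prop :=
  independent_vectors y /\ forall t, circular_gaussian (y t) K.

End GaussianSnapshots.

Section FisherInformation.
Variable R : realType.

(* Entrywise, through real and imaginary parts. *)
Definition partial_mx (n M : nat) (K : 'rV[R]_n -> 'M[R[i]]_M)
    (g : 'rV[R]_n) (i : 'I_n) : 'M[R[i]]_M :=
  \matrix_(m, l)
    ('D_(delta_mx 0 i) (fun h => complex.Re (K h m l)) g
     +i* 'D_(delta_mx 0 i) (fun h => complex.Im (K h m l)) g).

(* Fisher information about g carried by T independent circularly symmetric
   complex Gaussian snapshots with mean 0 and covariance K g. *)
Definition fisher_info (T n M : nat) (K : 'rV[R]_n -> 'M[R[i]]_M)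
    (g : 'rV[R]_n) : 'M[R]_n :=
  \matrix_(i, j)
    (T%:R * complex.Re
       (((vec (partial_mx K g i)) ^t*
         *m ((invmx (K g))^T *t invmx (K g))
         *m vec (partial_mx K g j)) 0 0)).

(* Bound for the first p of p + q parameters, all p + q being unknown. *)
Definition crlb (p q : nat) (F : 'M[R]_(p + q)) : 'M[R]_p :=
  ulsubmx (invmx F).

Definition crlb_marginal (p q : nat) (F : 'M[R]_(p + q)) (i : 'I_p) : R :=
  crlb F i i.

End FisherInformation.

(* Main.v *)
(* Since the covariance K is Hermitian, so is W = K^-T (x) K^-1, hence
   Re (u^H W v) is symmetric in u and v and the Fisher matrix F is symmetric.
   The bound for the parameters of interest is the upper left block of F^-1;
   the first block column of F F^-1 = 1 identifies it as the inverse of the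
   Schur complement of the nuisance block. *)

Require Import Defs.
From HB Require Import structures.
From mathcomp Require Import all_boot all_order all_algebra.
From mathcomp Require Import all_classical all_reals all_analysis.
From mathcomp.real_closed Require Import complex mxtens.

Set Implicit Arguments.
Unset Strict Implicit.
Unset Printing Implicit Defensive.

Import Order.TTheory GRing.Theory Num.Theory.
Import numFieldNormedType.Exports.

Local Open Scope ring_scope.

Lemma schur_complement_inv (F : fieldType) (p q : nat) (A : 'M[F]_(p + q)) :
    drsubmx A \in unitmx -> A \in unitmx ->
  let S := ulsubmx A - ursubmx A *m invmx (drsubmx A) *m dlsubmx A in
  S \in unitmx /\ ulsubmx (invmx A) = invmx S.
Proof.
move=> D_unit A_unit S.
have := mulmxV A_unit.
rewrite -{1}(submxK A) -{1}(submxK (invmx A)) mulmx_block scalar_mx_block.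
move=> /eq_block_mx[ul_eq _ dl_eq _].
(* The lower left block equation is solved for the lower left block of the inverse: writing that
   block as [D^-1 (D Z)] lets [D^-1] factor out of the sum. *)
have dl_inv : dlsubmx (invmx A) =
    - (invmx (drsubmx A) *m dlsubmx A *m ulsubmx (invmx A)).
  apply/eqP; rewrite -addr_eq0 -[X in X + _](mulKmx D_unit) -!mulmxA -mulmxDr.
  by rewrite addrC dl_eq mulmx0.
have S_inv : S *m ulsubmx (invmx A) = 1%:M.
  by rewrite mulmxBl -ul_eq dl_inv mulmxN !mulmxA.
(* A one-sided inverse of a square matrix over a field suffices, so nonsingularity of [S] is a
   conclusion here. *)
have [S_unit _] := mulmx1_unit S_inv.
by split=> //; rewrite -[LHS](mulKmx S_unit) S_inv mulmx1.
Qed.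

Section HermitianCovariance.
Variable R : realType.
Local Open Scope complex_scope.
Local Open Scope sesquilinear_scope.

Lemma trCmx_mul (m n p : nat) (A : 'M[R[i]]_(m, n)) (B : 'M[R[i]]_(n, p)) :
  (A *m B) ^t* = B ^t* *m A ^t*.
Proof. by rewrite trmx_mul map_mxM. Qed.

Lemma trCmx_inv (n : nat) (A : 'M[R[i]]_n) : (invmx A) ^t* = invmx (A ^t*).
Proof. by rewrite trmx_inv map_invmx. Qed.

Lemma trCmx_tens (m n p q : nat) (A : 'M[R[i]]_(m, n)) (B : 'M[R[i]]_(p, q)) :
  (A *t B) ^t* = A ^t* *t B ^t*.
Proof. by rewrite trmx_tens map_mxT. Qed.

Lemma fisher_info_sym (T n M : nat) (K : 'rV[R]_n -> 'M[R[i]]_M)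
    (g : 'rV[R]_n) :
  (K g) ^t* = K g -> (fisher_info T K g)^T = fisher_info T K g.
Proof.
move=> K_herm; apply/matrixP=> i j; rewrite mxE [LHS]mxE [RHS]mxE.
set W := (_ *t _).
have W_herm : W ^t* = W.
  rewrite /W trCmx_tens trCmx_inv K_herm; congr (_ *t _).
  (* For the factor [K^-T], replacing [K] by its conjugate transpose on the right turns both sides
     into the entrywise conjugate of [K^-1]. *)
  by rewrite -[in RHS]K_herm -trCmx_inv; apply/matrixP=> k l; rewrite !mxE.
have Re_conj (z : R[i]) : complex.Re (z^*)%R = complex.Re z by case: z.
(* Conjugating the scalar on the right costs nothing under the real part, and on a 1 by 1 matrix it
   is the conjugate transpose, which swaps the two vectors. *)
rewrite -[in RHS]Re_conj; congr (_ * complex.Re _).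
set u := vec _; set v := vec _.
suff -> : u ^t* *m W *m v = (v ^t* *m W *m u) ^t*
  by rewrite mxE [in LHS]mxE.
by rewrite !trCmx_mul trmxCK W_herm mulmxA.
Qed.

(** The matrix [a a^H] is Hermitian, the distortion is real and depends only on the distance between
    indices, and [rho], [sigma2] are real. *)
Lemma cov_PI_herm (M : nat) (d0 lambda11 theta kappa a3 rho sigma2 : R) :
  (cov_PI M d0 lambda11 theta kappa a3 rho sigma2) ^t* =
  cov_PI M d0 lambda11 theta kappa a3 rho sigma2.
Proof.
have real_conj (x : R) : (x%:C^*)%R = x%:C by exact: conjc_real.
have steering_herm : (steering_cov M d0 theta) ^t* = steering_cov M d0 theta.
  by rewrite trCmx_mul trmxCK.
have distortion_sym m l :
    distortion_cov M d0 lambda11 theta kappa a3 l m =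
    distortion_cov M d0 lambda11 theta kappa a3 m l.
  by rewrite !mxE distnC eq_sym.
(* Both factors stay folded so that their symmetries can be applied to single entries. *)
have cov_PIE m l : cov_PI M d0 lambda11 theta kappa a3 rho sigma2 m l =
    rho%:C * (steering_cov M d0 theta m l
              * (distortion_cov M d0 lambda11 theta kappa a3 m l)%:C)
    + sigma2%:C *+ (m == l).
  by rewrite !mxE.
apply/matrixP=> m l; rewrite 2!mxE !cov_PIE distortion_sym eq_sym.
rewrite rmorphD rmorphMn !rmorphM /= !real_conj -[in RHS]steering_herm.
by rewrite [in RHS]mxE [in RHS]mxE.
Qed.

End HermitianCovariance.

Theorem lemma3 (R : realType) (M T : nat)
    (d0 lambda11 theta kappa a3 rho sigma2 : R)
    (d : measure_display) (Omega : measurableType d) (P : probability Omega R)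
    (y : 'I_T -> Omega -> 'cV[complex R]_M)
    (d0_gt0 : 0 < d0) (lambda11_gt0 : 0 < lambda11)
    (theta_gt : - (pi / 2) < theta) (theta_lt : theta < pi / 2)
    (rho_gt0 : 0 < rho) (sigma2_gt0 : 0 < sigma2)
    (Ry_posdef : posdefmx (cov_PI M d0 lambda11 theta kappa a3 rho sigma2))
    (y_law : gaussian_snapshots P y
               (cov_PI M d0 lambda11 theta kappa a3 rho sigma2)) :
  let F : 'M[R]_(3 + 2) :=
    fisher_info T (cov_PI_of M d0 lambda11)
      (params theta kappa a3 rho sigma2) in
  let Fpp : 'M[R]_3 := ulsubmx F in
  let Fpn : 'M[R]_(3, 2) := ursubmx F in
  let Fnp : 'M[R]_(2, 3) := dlsubmx F in
  let Fnn : 'M[R]_2 := drsubmx F in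
  let C : 'M[R]_3 := invmx (Fpp - Fpn *m invmx Fnn *m Fnp) in
  Fnn \in unitmx ->
  F \in unitmx ->
  [/\ Fnp = Fpn^T,
      Fpp - Fpn *m invmx Fnn *m Fnp \in unitmx,
      crlb F = C &
      [/\ crlb_marginal F (0 : 'I_3) = C 0 0,
          crlb_marginal F (1 : 'I_3) = C 1 1 &
          crlb_marginal F (2%:R : 'I_3) = C 2%:R 2%:R]].
Proof.
move=> F Fpp Fpn Fnp Fnn C Fnn_unit F_unit.
have [S_unit crlbE] := schur_complement_inv Fnn_unit F_unit.
split=> //; last by rewrite /crlb_marginal /crlb crlbE.
(* The transposed upper right block of [F] is the lower left block of [F^T], and [F] is
   symmetric. *)
rewrite /Fnp /Fpn trmx_ursub fisher_info_sym //.
(* [cov_PI_herm] holds at all parameter values, so the coordinates of [params] stay unevaluated. *)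
by rewrite /cov_PI_of cov_PI_herm.
Qed.
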